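(* For every (finite) hypergraph $\mathcal{H}$ (multi-edges and empty edges allowed), the closure homology of $\mathcal{H}$ is isomorphic to the closure homology of its dual $\mathcal{H}^*$, i.e. $\mathsf{H}^{\Delta}_{\bullet}(\mathcal{H})\cong \mathsf{H}^{\Delta}_{\bullet}(\mathcal{H}^* )$.
   Context: A hypergraph $\mathcal{H}=(V,E,\epsilon)$ (an object of the category $\mathbf{MHyp}$) consists of a finite set $V$ of vertices, a finite set $E$ of hyperedges, and a function $\epsilon:E\to 2^V$; one writes $v\in e$ for $v\in\epsilon(e)$. Multi-edges and empty edges are allowed. The dual $\mathcal{H}^*=(E^*,V^* )$ of $\mathcal{H}$ has vertex set $E^*=\{e^*:e\in E\}$ and hyperedges $V^*=\{v^*:v\in V\}$, where $v^*$ contains exactly the vertices $e^*$ with $v\in e$ in $\mathcal{H}$. All copies of a multi-edge give distinct vertices of $\mathcal{H}^*$. The upper closure $\Delta(\mathcal{H})$ is the abstract simplicial complex whose simplices are all nonempty subsets of $V$ contained in some hyperedge of $\mathcal{H}$. The closure homology is the simplicial homology $\mathsf{H}^{\Delta}_{\bullet}(\mathcal{H}):=\mathsf{H}_{\bullet}(\Delta(\mathcal{H}))$ in all dimensions, with coefficients in $\mathbb{Z}/2\mathbb{Z}$. *)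

(* Defs.v *)
From HB Require Import structures.
From mathcomp Require Import all_boot all_algebra.

Set Implicit Arguments.
Unset Strict Implicit.
Unset Printing Implicit Defensive.

Import GRing.Theory.
Local Open Scope ring_scope.
Local Open Scope quotient_scope.

(* [edge] is an arbitrary finite type and [edge_set] need not be injective, so
   multi-edges are allowed; [edge_set e] may be empty. *)
Record hypergraph := Hypergraph {
  vertex : finType;
  edge : finType;
  edge_set : edge -> {set vertex}
}.

(* The vertex e^* and the hyperedge v^* are represented by e and v themselves;
   in particular parallel hyperedges give distinct vertices of the dual. *)
Definition dual (H : hypergraph) : hypergraph :=
  @Hypergraph (edge H) (vertex H) (fun v => [set e | v \in edge_set e]).

(* Points of [V] are not required to be vertices of the complex. *)
Record scomplex (V : finType) := SComplex {
  simplices :> {set {set V}};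
  simplices_nonempty : set0 \notin simplices;
  simplices_closed : forall s t : {set V},
    s \in simplices -> t \subset s -> t != set0 -> t \in simplices
}.

Definition closure_simplices (H : hypergraph) : {set {set vertex H}} :=
  [set s | (s != set0) && [exists e : edge H, s \subset edge_set e]].

Lemma closure_simplices_nonempty H : set0 \notin closure_simplices H.
Proof. by rewrite inE eqxx. Qed.

Lemma closure_simplices_closed H (s t : {set vertex H}) :
  s \in closure_simplices H -> t \subset s -> t != set0 ->
  t \in closure_simplices H.
Proof.
rewrite !inE => /andP[_ /existsP[e se]] ts ->.
by apply/existsP; exists e; apply: subset_trans se.
Qed.

Definition upper_closure (H : hypergraph) : scomplex (vertex H) :=
  SComplex (closure_simplices_nonempty H) (@closure_simplices_closed H).

Section QuotientSpace.

Variables (K : fieldType) (vT : vectType K) (U : {vspace vT}).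

Definition quotient_space := Quotient.quot (pred_of_vspace U).

HB.instance Definition _ := GRing.Zmodule.on quotient_space.

Definition quotient_proj (v : vT) : quotient_space :=
  \pi_(Quotient.quot (pred_of_vspace U)) v.

Definition quotient_repr (x : quotient_space) : vT := repr x.

Lemma quotient_reprK : cancel quotient_repr quotient_proj.
Proof. exact: reprK. Qed.

Lemma quotient_projP (u v : vT) :
  reflect (quotient_proj u = quotient_proj v) (u - v \in U).
Proof.
by rewrite (Quotient.idealrBE (pred_of_vspace U)); apply: eqP.
Qed.

Lemma quotient_projD : {morph quotient_proj : u v / u + v}.
Proof. exact: (raddfD (\pi_(Quotient.quot (pred_of_vspace U)))). Qed.

Definition quotient_scale (a : K) (x : quotient_space) : quotient_space :=
  quotient_proj (a *: quotient_repr x).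

Lemma quotient_projZ a (v : vT) :
  quotient_scale a (quotient_proj v) = quotient_proj (a *: v).
Proof.
apply/quotient_projP; rewrite -scalerBr memvZ //.
by apply/quotient_projP; rewrite quotient_reprK.
Qed.

Fact quotient_scaleA a b x :
  quotient_scale a (quotient_scale b x) = quotient_scale (a * b) x.
Proof. by rewrite -(quotient_reprK x) !quotient_projZ scalerA. Qed.

Fact quotient_scale1 : left_id 1 quotient_scale.
Proof.
by move=> x; rewrite -(quotient_reprK x) quotient_projZ scale1r.
Qed.

Fact quotient_scaleDr : right_distributive quotient_scale +%R.
Proof.
move=> a x y; rewrite -(quotient_reprK x) -(quotient_reprK y).
by rewrite -quotient_projD !quotient_projZ scalerDr quotient_projD.
Qed.

Fact quotient_scaleDl x : {morph quotient_scale^~ x : a b / a + b}.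
Proof.
move=> a b /=; rewrite -(quotient_reprK x) !quotient_projZ.
by rewrite scalerDl quotient_projD.
Qed.

HB.instance Definition _ := GRing.Zmodule_isLmodule.Build K quotient_space
  quotient_scaleA quotient_scale1 quotient_scaleDr quotient_scaleDl.

Fact quotient_proj_linear : linear quotient_proj.
Proof. by move=> a u v; rewrite quotient_projD -quotient_projZ. Qed.

HB.instance Definition _ := GRing.isLinear.Build K vT quotient_space _
  quotient_proj quotient_proj_linear.

End QuotientSpace.

Definition lmod_iso (K : fieldType) (M N : lmodType K) : Prop :=
  exists f : {linear M -> N}, bijective f.

Section SimplicialHomology.

Variables (V : finType) (K : scomplex V).

Definition simplex (n : nat) := {s : {set V} | (s \in K) && (#|s| == n.+1)}.

(* The regular module [('F_2)^o] makes this a vector space over ['F_2]. *)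
Definition chain (n : nat) := {ffun simplex n -> ('F_2)^o}.

(* Since signs are irrelevant modulo 2, the coefficient of [t] in the boundary
   of [c] is the sum of the coefficients in [c] of the simplices having [t] as
   a facet. *)
Definition boundary_fun (n : nat) (c : chain n.+1) : chain n :=
  [ffun t : simplex n => \sum_(s : simplex n.+1 | val t \subset val s) c s].

Fact boundary_fun_linear n : linear (@boundary_fun n).
Proof.
move=> a c d; apply/ffunP=> t; rewrite !ffunE scaler_sumr -big_split /=.
by apply: eq_bigr => s _; rewrite !ffunE.
Qed.

HB.instance Definition _ n := GRing.isLinear.Build 'F_2 (chain n.+1) (chain n)
  _ (@boundary_fun n) (@boundary_fun_linear n).

Definition boundary (n : nat) : 'Hom(chain n.+1, chain n) :=
  linfun (@boundary_fun n).

(* Unreduced homology: every 0-chain is a cycle. *)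
Definition cycles (n : nat) : {vspace chain n} :=
  match n return {vspace chain n} with
  | 0 => fullv
  | m.+1 => lker (boundary m)
  end.

Definition boundaries (n : nat) : {vspace chain n} := limg (boundary n).

(* The boundaries, as a subspace of the space of cycles. *)
Definition boundaries_in_cycles (n : nat) : {vspace subvs_of (cycles n)} :=
  (linfun (@vsval _ _ (cycles n)) @^-1: boundaries n)%VS.

Definition homology (n : nat) : lmodType 'F_2 :=
  quotient_space (boundaries_in_cycles n).

Lemma boundary_boundary n (c : chain n.+2) : boundary n (boundary n.+1 c) = 0.
Proof.
rewrite !lfunE /=; apply/ffunP=> t; rewrite !ffunE.
under eq_bigr => u _ do rewrite ffunE.
rewrite (exchange_big_dep xpredT) //= big1 // => s _.
rewrite sumr_const.
set A := (X in #|X|).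
have [ts|nts] := boolP (val t \subset val s); last first.
  rewrite eq_card0 // => u; rewrite !inE; apply/negP => /andP[tu us].
  by case/negP: nts; apply: subset_trans us.
have [/andP[tK /eqP tc] /andP[sK /eqP sc]] := (valP t, valP s).
have -> : #|A| = #|val s :\: val t|.
  rewrite -(card_image val_inj A).
  have inj : {in val s :\: val t &, injective (fun v => v |: val t)}.
    move=> v w; rewrite !inE => /andP[vt _] _ /setP/(_ v).
    by rewrite !inE eqxx (negPf vt) !orbF => /esym/eqP.
  rewrite -(card_in_imset inj); apply: eq_card => B.
  apply/imageP/imsetP => [[u]|[v]].
    rewrite [u \in A]/(A u) => /andP[tu us] ->; have /andP[uK /eqP uc] := valP u.
    have : #|val u :\: val t| == 1%N.
      by rewrite cardsD (setIidPr tu) uc tc subSn // subnn.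
    case/cards1P => v uv; have /setDP[vu vt] : v \in val u :\: val t.
      by rewrite uv set11.
    exists v; first by rewrite !inE vt (subsetP us).
    by rewrite -uv setUC -{1}(setID (val u) (val t)) (setIidPr tu).
  rewrite !inE => /andP[vt vs] ->.
  have vts : v |: val t \subset val s by rewrite subUset sub1set vs.
  have P : ((v |: val t) \in K) && (#|v |: val t| == n.+2).
    rewrite cardsU1 vt tc add1n eqxx andbT (simplices_closed sK) //.
    by apply/set0Pn; exists v; rewrite setU11.
  exists (Sub (v |: val t) P : simplex n.+1) => //.
  exact/andP/(conj (subsetUr _ _) vts).
have -> : #|val s :\: val t| = 2.
  by rewrite cardsD (setIidPr ts) sc tc !subSS -addn2 addKn.
by rewrite mulr2n; apply: (@addrr_pchar2 'F_2);
  rewrite (pchar_Fp (isT : prime 2)).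
Qed.

Lemma boundaries_sub_cycles n : (boundaries n <= cycles n)%VS.
Proof.
case: n => [|n]; first exact: subvf.
apply/subvP => _ /memv_imgP[c _ ->].
by rewrite memv_ker boundary_boundary.
Qed.

End SimplicialHomology.

Definition closure_homology (H : hypergraph) (n : nat) : lmodType 'F_2 :=
  homology (upper_closure H) n.

(* Main.v *)
(* The Dowker complex of H has vertex set V + E; its simplices are the nonempty
   unions of a set a of vertices and a set b of hyperedges such that every v in
   a lies in every e in b, a is contained in some hyperedge, and the hyperedges
   in b share some vertex.  It contains the closure complex of H (take b empty)
   and, up to exchanging V and E, it is the Dowker complex of the dual of H.
   It collapses onto the closure complex: for a fixed nonempty b, the
   hyperedges of b share a vertex v, and adding or removing v pairs up all the
   simplices with hyperedge part b, so that they may be discarded without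
   changing the homology, starting with the largest sets b. *)
From HB Require Import structures.
Require Import Defs.
From mathcomp Require Import all_boot all_algebra.

Set Implicit Arguments.
Unset Strict Implicit.
Unset Printing Implicit Defensive.

Import GRing.Theory.
Local Open Scope ring_scope.

(** * Isomorphisms between subquotients of vector spaces *)

Lemma lmod_iso_sym (K : fieldType) (M N : lmodType K) :
  lmod_iso M N -> lmod_iso N M.
Proof.
case=> f [g fK gK].
pose gL := GRing.isLinear.Build K N M _ g (can2_linear fK gK).
pose h : {linear N -> M} := HB.pack g gL.
by exists h, f.
Qed.

Lemma lmod_iso_trans (K : fieldType) (M N P : lmodType K) :
  lmod_iso M N -> lmod_iso N P -> lmod_iso M P.
Proof. by case=> f fb [g gb]; exists (g \o f); apply: bij_comp. Qed.

Section Subquotient.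

Variables (K : fieldType) (vT : vectType K) (Z B : {vspace vT}).

(** This is Z / (Z ∩ B). For [Z] the cycles and [B] the boundaries it unfolds to [homology], so that
    [subquotient_iso] applies to homology as it stands. *)
Definition subquotient : lmodType K :=
  quotient_space (linfun (@vsval _ _ Z) @^-1: B)%VS.

Definition subquotient_class (u : subvs_of Z) : subquotient :=
  quotient_proj (linfun (@vsval _ _ Z) @^-1: B)%VS u.

Definition subquotient_repr (x : subquotient) : subvs_of Z :=
  quotient_repr x.

Lemma subquotient_reprK : cancel subquotient_repr subquotient_class.
Proof. exact: quotient_reprK. Qed.

Lemma subquotient_class_linear : linear subquotient_class.
Proof. exact: quotient_proj_linear. Qed.

Lemma subquotient_classP (u v : subvs_of Z) :
  reflect (subquotient_class u = subquotient_class v) (vsval u - vsval v \in B).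
Proof.
have -> : (vsval u - vsval v \in B)
    = (u - v \in (linfun (@vsval _ _ Z) @^-1: B)%VS).
  by rewrite -memv_preim lfunE raddfB.
exact: quotient_projP.
Qed.

End Subquotient.

(** The equality in the second hypothesis does double duty: one direction makes the induced map well
    defined, the other makes it injective. The third hypothesis is surjectivity modulo [B']. *)
Lemma subquotient_iso (K : fieldType) (vT wT : vectType K)
    (Z B : {vspace vT}) (Z' B' : {vspace wT}) (f : {linear vT -> wT}) :
    (forall u, u \in Z -> f u \in Z') ->
    (forall u, u \in Z -> (f u \in B') = (u \in B)) ->
    (forall w, w \in Z' -> exists2 u, u \in Z & w - f u \in B') ->
  lmod_iso (subquotient Z B) (subquotient Z' B').
Proof.
move=> fZ fB fsurj.
pose F0 (u : subvs_of Z) : subvs_of Z' := vsproj Z' (f (vsval u)).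
have valF0 u : vsval (F0 u) = f (vsval u) by rewrite vsprojK ?fZ ?subvsP.
(* [F] acts on a chosen representative; [FE] below shows that the choice is immaterial. *)
pose F (x : subquotient Z B) := subquotient_class B' (F0 (subquotient_repr x)).
have eqF0 u v :
    (vsval (F0 u) - vsval (F0 v) \in B') = (vsval u - vsval v \in B).
  by rewrite !valF0 -linearB fB // memvB ?subvsP.
have FE u : F (subquotient_class B u) = subquotient_class B' (F0 u).
  apply/subquotient_classP; rewrite eqF0.
  by apply/subquotient_classP; rewrite subquotient_reprK.
have Flin : linear F.
  move=> a x y; rewrite -[x]subquotient_reprK -[y]subquotient_reprK.
  rewrite -subquotient_class_linear !FE -subquotient_class_linear /F0.
  by congr subquotient_class; rewrite !linearP.
pose FL := GRing.isLinear.Build K _ _ _ F Flin.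
pose G : {linear subquotient Z B -> subquotient Z' B'} := HB.pack F FL.
exists G.
have Finj : injective F.
  move=> x y; rewrite -[x]subquotient_reprK -[y]subquotient_reprK !FE.
  by move=> /subquotient_classP; rewrite eqF0 => /subquotient_classP.
have Fsurj y : exists x, F x == y.
  have [u uZ uB] := fsurj _ (subvsP (subquotient_repr y)).
  exists (subquotient_class B (vsproj Z u)).
  rewrite FE -[y]subquotient_reprK eq_sym.
  by apply/eqP/subquotient_classP; rewrite valF0 vsprojK.
(* A right inverse is chosen pointwise; injectivity makes it two-sided. *)
pose g y := xchoose (Fsurj y).
have gK : cancel g F by move=> y; apply/eqP/(xchooseP (Fsurj y)).
by exists g => // x; apply: Finj; rewrite gK.
Qed.

(** * Chains modulo 2 as functions on all sets of vertices *)

Lemma addrr_F2 (x : 'F_2) : x + x = 0.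
Proof. by apply: (@addrr_pchar2 'F_2); rewrite (pchar_Fp (isT : prime 2)). Qed.

Section Extension.

Variables (V : finType) (K : scomplex V).
Implicit Types (n : nat) (s t : {set V}) (phi : {set V} -> 'F_2).

(* Chains are handled as functions on all sets of vertices, extended by zero. *)
Definition extend n (c : chain K n) s : 'F_2 :=
  if (insub s : option (simplex K n)) is Some u then c u else 0.

Definition restrict n phi : chain K n := [ffun s => phi (val s)].

(** Summing over the added vertex instead of over simplices keeps the complex and the dimension out
    of the formula, so it reads the same in a complex and in a subcomplex. *)
Definition mod2_boundary phi t : 'F_2 := \sum_(x | x \notin t) phi (x |: t).

Lemma extend_val n (c : chain K n) (s : simplex K n) : extend c (val s) = c s.
Proof. by rewrite /extend valK. Qed.

Lemma extend_out n (c : chain K n) s :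
  ~~ ((s \in K) && (#|s| == n.+1)) -> extend c s = 0.
Proof. by move=> sK; rewrite /extend insubN. Qed.

Lemma extend_supp n (c : chain K n) s :
  extend c s != 0 -> (s \in K) && (#|s| == n.+1).
Proof. by apply: contraNT => /extend_out->. Qed.

Lemma restrictK n phi :
    (forall s, phi s != 0 -> (s \in K) && (#|s| == n.+1)) ->
  extend (restrict n phi) =1 phi.
Proof.
move=> phiK s; rewrite /extend; case: insubP => [u _ <-|sK].
  by rewrite ffunE.
by apply/eqP; rewrite eq_sym; apply: contraNT sK; apply: phiK.
Qed.

Lemma extend_inj n (c d : chain K n) : extend c =1 extend d -> c = d.
Proof. by move=> cd; apply/ffunP=> s; rewrite -!extend_val cd. Qed.

Lemma extendD n (c d : chain K n) s :
  extend (c + d) s = extend c s + extend d s.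
Proof.
by rewrite /extend; case: insubP => [u _ _|_]; rewrite ?ffunE ?addr0.
Qed.

Lemma extend0 n s : extend (0 : chain K n) s = 0.
Proof. by rewrite /extend; case: insubP => // u _ _; rewrite ffunE. Qed.

Lemma extendZ n a (c : chain K n) s : extend (a *: c) s = a * extend c s.
Proof.
by rewrite /extend; case: insubP => [u _ _|_]; rewrite ?ffunE ?mulr0.
Qed.

Lemma extend_boundary n (c : chain K n.+1) t :
  t != set0 -> extend (boundary K n c) t = mod2_boundary (extend c) t.
Proof.
move=> t0; have [tK|tK] := boolP ((t \in K) && (#|t| == n.+1)); last first.
  rewrite extend_out // /mod2_boundary big1 // => x xt; apply/extend_out.
  apply: contra tK => /andP[xK /eqP]; rewrite cardsU1 xt add1n => -[->].
  by rewrite (simplices_closed xK) ?eqxx ?subsetUr.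
have -> : extend (boundary K n c) t
    = \sum_(s : simplex K n.+1 | t \subset val s) c s.
  by rewrite -[t](SubK (simplex K n) tK) extend_val lfunE ffunE.
have /andP[_ /eqP tn] := tK.
(* [Q] consists of all sets with one more element than [t] that contain [t], simplices or not; those
   outside [K] contribute zero. Adding a point to [t] is injective off [t], so a sum over [Q] is a
   sum over points. *)
pose Q := [set x |: t | x in ~: t].
have QE s : (s \in Q) = (t \subset s) && (#|s| == n.+2).
  apply/imsetP/andP => [[x]|[ts /eqP sn]].
    by rewrite inE => xt ->; rewrite subsetUr cardsU1 xt tn.
  have : #|s :\: t| == 1%N by rewrite cardsD (setIidPr ts) sn tn subSn // subnn.
  case/cards1P => x sx; have : x \in s :\: t by rewrite sx set11.
  rewrite inE => /andP[xt xs]; exists x; first by rewrite inE.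
  by rewrite -sx setUC -{1}(setID s t) (setIidPr ts).
transitivity (\sum_(s in Q) extend c s).
  under eq_bigr do rewrite -extend_val.
  pose T := [pred u : simplex K n.+1 | t \subset val u].
  rewrite -(big_imset (h := val) (A := T)); last by move=> u v _ _ /val_inj.
  rewrite big_mkcond [RHS]big_mkcond; apply: eq_bigr => s _; rewrite QE.
  have [sK|sK] := boolP ((s \in K) && (#|s| == n.+2)); last first.
    by rewrite extend_out // !if_same.
  have /andP[_ ->] := sK; rewrite andbT; congr (if _ then _ else _).
  have sE : val (Sub s sK : simplex K n.+1) = s by [].
  by rewrite -{1}sE mem_imset ?inE //; apply: val_inj.
rewrite big_imset /=.
  by apply: eq_bigl => x; rewrite inE.
move=> x y; rewrite !inE => xt yt /setP/(_ x).
by rewrite !inE eqxx (negPf xt) !orbF => /esym/eqP.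
Qed.

Lemma mod2_boundary_eq0 n (c : chain K n) t :
  #|t| != n -> mod2_boundary (extend c) t = 0.
Proof.
move=> tn; rewrite /mod2_boundary big1 // => x xt; apply: extend_out.
by rewrite cardsU1 xt add1n eqSS (negPf tn) andbF.
Qed.

(** Leaving out the empty set is what matches unreduced homology: for [n = 0] the sum at [set0] is
    the augmentation, which need not vanish on a cycle. *)
Lemma cyclesP n (c : chain K n) :
  c \in cycles K n <-> (forall t, t != set0 -> mod2_boundary (extend c) t = 0).
Proof.
case: n c => [|n] c; split=> [cZ t t0|cZ].
- by rewrite mod2_boundary_eq0 ?cards_eq0.
- by rewrite memvf.
- by move: cZ; rewrite memv_ker -extend_boundary // => /eqP->; rewrite extend0.
rewrite memv_ker; apply/eqP/extend_inj => t; rewrite extend0.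
have [->|t0] := eqVneq t set0; last by rewrite extend_boundary ?cZ.
by rewrite extend_out // cards0 andbF.
Qed.

Lemma boundariesP n (c : chain K n) :
  c \in boundaries K n <-> exists b, c = boundary K n b.
Proof.
split=> [/memv_imgP[b _ ->]|[b ->]]; first by exists b.
by rewrite memv_img ?memvf.
Qed.

End Extension.

(** * Subcomplexes whose complement is paired up by toggling a vertex *)

Section Inclusion.

Variables (W : finType) (K M : scomplex W).
Hypothesis KM : {subset K <= M}.

Definition inclusion n (c : chain K n) : chain M n := restrict M n (extend c).

Lemma extend_inclusion n (c : chain K n) : extend (inclusion c) =1 extend c.
Proof.
by apply: restrictK => s /extend_supp/andP[/KM-> ->].
Qed.

Lemma inclusion_linear n : linear (@inclusion n).
Proof. by move=> a c d; apply/ffunP => s; rewrite !ffunE extendD extendZ. Qed.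

HB.instance Definition _ n := GRing.isLinear.Build 'F_2 (chain K n) (chain M n)
  _ (@inclusion n) (@inclusion_linear n).

Lemma inclusion_inj n : injective (@inclusion n).
Proof.
by move=> c d cd; apply: extend_inj => s; rewrite -!extend_inclusion cd.
Qed.

Lemma mod2_boundary_inclusion n (c : chain K n) :
  mod2_boundary (extend (inclusion c)) =1 mod2_boundary (extend c).
Proof. by move=> t; apply: eq_bigr => x _; rewrite extend_inclusion. Qed.

Lemma boundary_inclusion n (c : chain K n.+1) :
  boundary M n (inclusion c) = inclusion (boundary K n c).
Proof.
apply: extend_inj => t; have [->|t0] := eqVneq t set0.
  by rewrite !extend_out // cards0 andbF.
by rewrite extend_inclusion !extend_boundary // mod2_boundary_inclusion.
Qed.

Lemma inclusion_cycles n (c : chain K n) :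
  inclusion c \in cycles M n <-> c \in cycles K n.
Proof.
by split=> /cyclesP cZ; apply/cyclesP => t t0;
  rewrite -(cZ t t0) mod2_boundary_inclusion.
Qed.

Variable v : W.
Hypothesis addv : forall s, s \in M :\: K -> v |: s \in M :\: K.
Hypothesis remv : forall s, s \in M :\: K -> s :\ v \in M :\: K.

(* The operator [h] adding [v] to the simplices outside [K] that avoid it is a
   chain homotopy contracting [M] modulo [K]: it is used in the form
   [c + dhc + hdc] lies in [K], under a hypothesis on [c] making [hdc] vanish. *)
Lemma push_into_subcomplex n (c : chain M n) :
    (forall t, t \in M :\: K -> mod2_boundary (extend c) t = 0) ->
  exists b : chain M n.+1, exists u : chain K n,
    c + boundary M n b = inclusion u.
Proof.
move=> cA; pose phi := extend c; pose A := M :\: K.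
pose h s := if (s \in A) && (v \in s) then phi (s :\ v) else 0.
pose b := restrict M n.+1 h.
have bE : extend b =1 h.
  apply: restrictK => s; rewrite /h; case: ifP; last by rewrite eqxx.
  move=> /andP[/setDP[-> _] vs] /extend_supp/andP[_ /eqP sn].
  by rewrite (cardsD1 v) vs sn add1n eqxx.
(* The element of [K] is the restriction of c + dhc; what remains is that c + dhc vanishes on
   [A]. *)
exists b, (restrict K n (extend (c + boundary M n b))).
apply: extend_inj => s; rewrite extend_inclusion; apply/esym.
apply: restrictK => {}s; apply: contraNT => sK.
have [/andP[sM sn]|?] := boolP ((s \in M) && (#|s| == n.+1)); last first.
  by rewrite extend_out.
have sA : s \in A by rewrite inE sM; move: sK; rewrite sn andbT => ->.
have s0 : s != set0 by rewrite -cards_eq0 (eqP sn).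
rewrite extendD extend_boundary // -/phi /mod2_boundary.
under eq_bigr do rewrite bE.
(* If [v] lies in [s], the whole expression is the boundary of [c] at [s :\ v], with [phi s] as its
   term for [x = v]; it vanishes by [cA]. *)
have [vs|vs] := boolP (v \in s).
  apply/eqP; rewrite -[RHS](cA _ (remv sA)) /mod2_boundary.
  rewrite [RHS](bigD1 v) ?setD11 //=.
  rewrite setD1K //; congr (_ + _).
  have xv x : x \notin s -> x != v by apply: contraNneq => ->.
  apply: eq_big => [x|x xs].
    rewrite !inE; have [->|_] := eqVneq x v; last by rewrite andbT.
    by rewrite vs.
  have xsE : (x |: s) :\ v = x |: (s :\ v).
    rewrite setDUl; congr (_ :|: _); apply/setDidPl.
    by rewrite disjoints1 inE xv.
  rewrite /h setU1r // andbT xsE -/phi; case: ifP => // /negbT xsA.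
  (* When [x |: s] is not in [A], the set [x |: (s :\ v)] cannot be a simplex of [M]: containing
     [s :\ v], it would lie outside [K], and adding [v] would put [x |: s] in [A]. So [phi] is zero
     there as well. *)
  apply/esym/extend_out; apply: contra xsA => /andP[xsM _].
  have xA : x |: (s :\ v) \in A.
    rewrite inE xsM andbT; have /setDP[svM svK] := remv sA.
    apply: contra svK => /simplices_closed; apply; first exact: subsetUr.
    by apply: contraTneq svM => ->; apply: simplices_nonempty.
  by have := addv xA; rewrite -xsE setD1K // setU1r.
(* If [v] is not in [s], only the term for [x = v] survives; it equals [phi s] and cancels it modulo
   2. *)
rewrite (bigD1 v) //= {1}/h addv // setU11 setU1K // big1 ?addr0 ?addrr_F2 //.
move=> x /andP[_ xv]; rewrite /h !inE [v == x]eq_sym (negPf xv) (negPf vs).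
by rewrite andbF.
Qed.

(** Pushing a cycle of [M] into [K] gives surjectivity. For injectivity, let a chain of [K] bound
    [b] in [M]. The boundary of [b] vanishes outside [K], so [b] itself can be pushed into [K], and
    this changes it by a boundary only. *)
Lemma toggle_homology n : lmod_iso (homology K n) (homology M n).
Proof.
apply: (subquotient_iso (f := @inclusion n)) => [c|u uZ|z zZ].
- by move/inclusion_cycles.
- apply/idP/idP => /boundariesP[b]; last first.
    by move=> -> /=; rewrite -boundary_inclusion; apply/boundariesP;
      exists (inclusion b).
  move=> ub; have [|e [w bw]] := @push_into_subcomplex _ b.
    move=> t /setDP[tM tK]; have t0 : t != set0.
      by apply: contraTneq tM => ->; apply: simplices_nonempty.
    by rewrite -extend_boundary // -ub extend_inclusion
      extend_out // (negPf tK).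
  apply/boundariesP; exists w; apply: inclusion_inj.
  by rewrite -boundary_inclusion -bw linearD /= boundary_boundary addr0.
have [|b [u zu]] := @push_into_subcomplex _ z.
  move=> t /setDP[tM tK]; move/cyclesP: zZ; apply.
  by apply: contraTneq tM => ->; apply: simplices_nonempty.
have bB : boundary M n b \in boundaries M n by apply/boundariesP; exists b.
exists u.
  apply/inclusion_cycles.
  by rewrite -zu rpredD // (subvP (boundaries_sub_cycles _ _)).
by rewrite /= -zu opprD addNKr rpredN.
Qed.

End Inclusion.


(** * Invariance of homology under isomorphism of complexes *)

Section Relabel.

Variables (V W : finType) (K : scomplex V) (L : scomplex W).
Variables (f : {set V} -> {set W}) (g : {set W} -> {set V}).
Hypothesis fL : {in K, forall s, f s \in L}.
Hypothesis gK : {in L, forall t, g t \in K}.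
Hypothesis fK : {in K, cancel f g}.
Hypothesis gL : {in L, cancel g f}.
Hypothesis card_f : {in K, forall s, #|f s| = #|s|}.
Hypothesis sub_f :
  {in K &, forall s t : {set V}, (f s \subset f t) = (s \subset t)}.

Lemma relabel_subproof n (s : simplex K n) :
  (f (val s) \in L) && (#|f (val s)| == n.+1).
Proof. by have /andP[sK sn] := valP s; rewrite fL ?card_f. Qed.

Lemma unlabel_subproof n (t : simplex L n) :
  (g (val t) \in K) && (#|g (val t)| == n.+1).
Proof. by have /andP[tL tn] := valP t; rewrite -card_f ?gL ?gK. Qed.

Definition relabel n (s : simplex K n) : simplex L n :=
  Sub (f (val s)) (relabel_subproof s).
Definition unlabel n (t : simplex L n) : simplex K n :=
  Sub (g (val t)) (unlabel_subproof t).

Lemma relabelK n : cancel (@relabel n) (@unlabel n).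
Proof. by move=> s; apply: val_inj; rewrite /= fK //; case/andP: (valP s). Qed.

Lemma unlabelK n : cancel (@unlabel n) (@relabel n).
Proof. by move=> s; apply: val_inj; rewrite /= gL //; case/andP: (valP s). Qed.

Definition relabel_chain n (c : chain K n) : chain L n :=
  [ffun t => c (unlabel t)].
Definition unlabel_chain n (c : chain L n) : chain K n :=
  [ffun s => c (relabel s)].

Lemma relabel_chainK n : cancel (@relabel_chain n) (@unlabel_chain n).
Proof. by move=> c; apply/ffunP => s; rewrite !ffunE relabelK. Qed.

Lemma unlabel_chainK n : cancel (@unlabel_chain n) (@relabel_chain n).
Proof. by move=> c; apply/ffunP => s; rewrite !ffunE unlabelK. Qed.

Lemma relabel_chain_linear n : linear (@relabel_chain n).
Proof. by move=> a c d; apply/ffunP => t; rewrite !ffunE. Qed.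

HB.instance Definition _ n := GRing.isLinear.Build 'F_2 (chain K n) (chain L n)
  _ (@relabel_chain n) (@relabel_chain_linear n).

Lemma boundary_relabel n (c : chain K n.+1) :
  boundary L n (relabel_chain c) = relabel_chain (boundary K n c).
Proof.
apply/ffunP => t; rewrite !lfunE !ffunE (reindex (@relabel n.+1)); last first.
  by exists (@unlabel n.+1) => ? _; rewrite (relabelK, unlabelK).
apply: eq_big => [s|s _]; last by rewrite ffunE relabelK.
have /andP[sK _] := valP s; have /andP[tL _] := valP t.
by rewrite /= -[RHS]sub_f ?gK // gL.
Qed.

(** The isomorphism is given on simplices, not on vertices, because the ambient vertex types may
    differ in size, as for [vertex H] and [vertex H + edge H]. Preserving inclusion and cardinality
    is enough to preserve facets, hence boundaries. *)
Lemma relabel_homology n : lmod_iso (homology K n) (homology L n).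
Proof.
have cyc m (c : chain K m) :
    (relabel_chain c \in cycles L m) = (c \in cycles K m).
  case: m c => [|m] c; first by rewrite !memvf.
  rewrite !memv_ker boundary_relabel -(linear0 (@relabel_chain m)).
  by rewrite (inj_eq (can_inj (@relabel_chainK m))).
apply: (subquotient_iso (f := @relabel_chain n)) => [c|c _|z zZ] /=.
- by rewrite cyc.
- apply/idP/idP => /boundariesP[b].
    move=> cb; apply/boundariesP; exists (unlabel_chain b).
    apply: (can_inj (@relabel_chainK n)).
    by rewrite -boundary_relabel unlabel_chainK.
  move=> ->; apply/boundariesP; exists (relabel_chain b).
  by rewrite boundary_relabel.
by exists (unlabel_chain z); rewrite -?cyc unlabel_chainK // subrr rpred0.
Qed.

End Relabel.

(** * Collapsing a complex onto the simplices inside a vertex set *)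

Lemma eq_homology (V : finType) (K L : scomplex V) n :
  K =i L -> lmod_iso (homology K n) (homology L n).
Proof.
move=> KL; apply: (relabel_homology (f := id) (g := id)) => // s.
  by rewrite KL.
by rewrite -KL.
Qed.

(** Induction on the number of simplices of [M]: all simplices sharing one largest part outside [P]
    are removed at once, and [toggle_homology] applies to their common apex [v]. *)
Lemma collapse_homology (W : finType) (P : {set W}) (K M : scomplex W) n :
    (forall s, (s \in K) = (s \in M) && (s \subset P)) ->
    (forall s, s \in M -> ~~ (s \subset P) -> exists2 v, v \in P &
      forall s', s' \in M -> s' :\: P = s :\: P -> v |: s' \in M) ->
  lmod_iso (homology K n) (homology M n).
Proof.
have [m] := ubnP #|M|; elim: m M => // m IHm M ltMm KE coneM.
pose outside := [pred s | (s \in M) && ~~ (s \subset P)].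
have [/existsP[s0 s0P]|MP] := boolP [exists s, outside s].
  case: (@arg_maxnP _ s0 outside (fun s => #|s :\: P|) s0P).
  move=> s /andP[sM sP] smax.
  have sD0 : s :\: P != set0 by rewrite setD_eq0.
  pose S := [set s' in simplices M | s' :\: P != s :\: P].
  have S0 : set0 \notin S by rewrite inE (negPf (simplices_nonempty M)).
  (* If a face [u] of [t] has the removed outside part, that of [t] contains it, hence equals it by
     maximality; so [t] was removed too. *)
  have Sclosed (t u : {set W}) : t \in S -> u \subset t -> u != set0 -> u \in S.
    rewrite !inE => /andP[tM tD] ut u0; rewrite (simplices_closed tM) //=.
    apply: contraNneq tD => uD; rewrite eq_sym eqEcard -{1}uD setSD //.
    apply: smax; rewrite /= tM -setD_eq0; apply: contraNneq sD0 => t0.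
    by rewrite -subset0 -uD -t0 setSD.
  pose N := SComplex S0 Sclosed.
  have NE s' : (s' \in N) = (s' \in M) && (s' :\: P != s :\: P) by rewrite inE.
  have NM : {subset N <= M} by move=> s'; rewrite NE => /andP[].
  have ltNM : (#|N| < #|M|)%N.
    apply: proper_card; apply/properP; split; first exact/subsetP.
    by exists s => //; rewrite NE eqxx andbF.
  (* Simplices inside [P] all survive in [N], because [s :\: P] is nonempty. An apex for [M] still
     serves for [N], because adding a point of [P] leaves the outside part unchanged. *)
  have isoKN : lmod_iso (homology K n) (homology N n).
    apply: IHm; first exact: leq_trans ltNM _.
      move=> t; rewrite KE NE -andbA; congr (_ && _).
      have [tP|] := boolP (t \subset P); last by rewrite andbF.
      by rewrite (eqP (_ : t :\: P == set0)) ?setD_eq0 // eq_sym sD0.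
    move=> t; rewrite NE => /andP[tM tD] tP.
    have [v vP vM] := coneM _ tM tP; exists v => // s'.
    rewrite !NE => /andP[s'M _] s'D; rewrite vM //= setDUl s'D.
    by rewrite (eqP (_ : [set v] :\: P == set0)) ?setD_eq0 ?sub1set // set0U.
  apply: (lmod_iso_trans isoKN); have [v vP vM] := coneM _ sM sP.
  have MNE t : (t \in M :\: N) = (t \in M) && (t :\: P == s :\: P).
    by rewrite in_setD NE; case: (t \in M); rewrite ?andbF //= negbK andbT.
  have vP0 : [set v] :\: P = set0 by apply/eqP; rewrite setD_eq0 sub1set.
  apply: (toggle_homology NM (v := v)) => t; rewrite !MNE => /andP[tM /eqP tD].
    by rewrite vM //= setDUl vP0 set0U tD.
  have tvD : (t :\ v) :\: P = t :\: P.
    by rewrite setDDl (setUidPr _) // sub1set.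
  rewrite tvD tD eqxx andbT (simplices_closed tM) ?subD1set //.
  (* Removing [v] cannot empty the simplex, which keeps its nonempty part outside [P]. *)
  by apply: contraNneq sD0 => tv0; rewrite -tD -tvD tv0 set0D.
apply: eq_homology => s; rewrite KE.
have [sM|//] := boolP (s \in M); apply: contraNT MP => sP.
by apply/existsP; exists s; rewrite /= sM.
Qed.

(** * Full subcomplexes *)

Section Induced.

Variables (W : finType) (M : scomplex W) (P : {set W}).

Definition induced_simplices : {set {set W}} :=
  [set s in simplices M | s \subset P].

Lemma induced_simplices_nonempty : set0 \notin induced_simplices.
Proof. by rewrite inE (negPf (simplices_nonempty M)). Qed.

Lemma induced_simplices_closed (s t : {set W}) :
  s \in induced_simplices -> t \subset s -> t != set0 ->
  t \in induced_simplices.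
Proof.
rewrite !inE => /andP[sM sP] ts t0.
by rewrite (simplices_closed sM) //= (subset_trans ts).
Qed.

Definition induced : scomplex W :=
  SComplex induced_simplices_nonempty induced_simplices_closed.

Lemma in_induced s : (s \in induced) = (s \in M) && (s \subset P).
Proof. by rewrite inE. Qed.

End Induced.

(** * The Dowker complex and its collapse onto the closure complex *)

Section DowkerComplex.

Variables (H : hypergraph).
Implicit Types (v : vertex H) (e : edge H) (s : {set vertex H + edge H}).

(** The two existence clauses constrain the simplices lying on one side only, for which the last
    clause is vacuous. The definition is symmetric in vertices and hyperedges, as duality
    requires. *)
Definition dowker_simplices : {set {set vertex H + edge H}} :=
  [set s : {set vertex H + edge H} | [&& s != set0,
    [exists e, forall v, (inl v \in s) ==> (v \in edge_set e)],
    [exists v, forall e, (inr e \in s) ==> (v \in edge_set e)] &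
    [forall v, forall e,
      (inl v \in s) ==> (inr e \in s) ==> (v \in edge_set e)]]].

Lemma dowker_simplicesP s :
  reflect [/\ s != set0,
      exists e, forall v, inl v \in s -> v \in edge_set e,
      exists v, forall e, inr e \in s -> v \in edge_set e &
      forall v e, inl v \in s -> inr e \in s -> v \in edge_set e]
    (s \in dowker_simplices).
Proof.
rewrite inE; apply: (iffP and4P) => -[s0].
  move=> /existsP[e /'forall_implyP se] /existsP[v /'forall_implyP sv].
  move=> /'forall_'forall_implyP sR; split=> //; [by exists e | by exists v |].
  by move=> v' e' vs; apply/implyP/sR.
move=> [e se] [v sv] sR; split=> //.
- by apply/existsP; exists e; apply/'forall_implyP.
- by apply/existsP; exists v; apply/'forall_implyP.
apply/'forall_'forall_implyP => v' e' vs; apply/implyP; exact: sR.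
Qed.

Lemma dowker_simplices_nonempty : set0 \notin dowker_simplices.
Proof. by rewrite inE eqxx. Qed.

Lemma dowker_simplices_closed (s t : {set vertex H + edge H}) :
  s \in dowker_simplices -> t \subset s -> t != set0 -> t \in dowker_simplices.
Proof.
move=> /dowker_simplicesP[_ [e se] [v sv] sR] /subsetP ts t0.
apply/dowker_simplicesP; split=> //.
- by exists e => v' /ts/se.
- by exists v => e' /ts/sv.
by move=> v' e' /ts vs /ts es; apply: sR.
Qed.

Definition dowker_complex : scomplex (vertex H + edge H)%type :=
  SComplex dowker_simplices_nonempty dowker_simplices_closed.

Definition vertex_part : {set vertex H + edge H} := [set inl v | v : vertex H].

Definition vertex_complex : scomplex (vertex H + edge H)%type :=
  induced dowker_complex vertex_part.

Lemma in_vertex_part x :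
  (x \in vertex_part) = if x is inl _ then true else false.
Proof.
case: x => [v|e]; first by rewrite imset_f.
by apply/negbTE/imsetP => -[].
Qed.

Lemma vertex_complex_homology n :
  lmod_iso (homology vertex_complex n) (homology dowker_complex n).
Proof.
apply: (collapse_homology (P := vertex_part)) => [s|s sM].
  exact: in_induced.
case/subsetPn => -[v|e] es; rewrite in_vertex_part // => _.
have [_ _ [v sv] _] := dowker_simplicesP _ sM.
exists (inl v); first by rewrite in_vertex_part.
move=> t tM tP.
have partE e' : (inr e' \in t) = (inr e' \in s).
  by move/setP/(_ (inr e')): tP; rewrite !in_setD !in_vertex_part.
have [_ _ _ tR] := dowker_simplicesP _ tM.
have vE e' : inr e' \in t -> v \in edge_set e' by rewrite partE; apply: sv.
apply/dowker_simplicesP; split.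
- by apply/set0Pn; exists (inl v); rewrite setU11.
(* The hyperedge [e] outside [vertex_part] also belongs to [t], so it contains all vertices of [t],
   and it contains [v] by the choice of [v]. *)
- exists e => v'; rewrite !inE => /predU1P[[->]|]; first exact: sv.
  by move=> v't; apply: tR => //; rewrite partE.
- by exists v => e'; rewrite !inE => /vE.
move=> v' e'; rewrite !inE /= => /predU1P[[->] /vE //|v't e't].
exact: tR.
Qed.

Lemma closure_vertex_homology n :
  lmod_iso (closure_homology H n) (homology vertex_complex n).
Proof.
have inlI : injective (@inl (vertex H) (edge H)) by move=> ? ? [].
pose f (s : {set vertex H}) : {set vertex H + edge H} := inl @: s.
pose g (t : {set vertex H + edge H}) : {set vertex H} := inl @^-1: t.
have finl (s : {set vertex H}) v : (inl v \in f s) = (v \in s).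
  by rewrite mem_imset.
have finr (s : {set vertex H}) e : (inr e \in f s) = false.
  by apply/imsetP => -[].
have fK : cancel f g by move=> s; apply/setP => v; rewrite inE finl.
apply: (relabel_homology (f := f) (g := g)) => [s|t|s _|t|s _|s t _ _].
- rewrite in_induced inE => /andP[/set0Pn[v vs] /existsP[e /subsetP se]].
  apply/andP; split; last first.
    by apply/subsetP => _ /imsetP[w _ ->]; rewrite in_vertex_part.
  apply/dowker_simplicesP; split.
  + by apply/set0Pn; exists (inl v); rewrite finl.
  + by exists e => v'; rewrite finl => /se.
  (* There is no hyperedge to contain the witness, but a vertex must exist; nonemptiness of [s]
     supplies one. *)
  + by exists v => e'; rewrite finr.
  by move=> v' e'; rewrite finr.
- rewrite in_induced => /andP[/dowker_simplicesP[/set0Pn[x xt] [e te] _ _]].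
  move=> /subsetP/(_ x xt); rewrite in_vertex_part.
  case: x xt => // v vt _; rewrite inE; apply/andP; split.
    by apply/set0Pn; exists v; rewrite inE.
  by apply/existsP; exists e; apply/subsetP => v'; rewrite inE => /te.
- exact: fK.
- rewrite in_induced => /andP[_ /subsetP tP]; apply/setP => -[v|e].
    by rewrite finl inE.
  by rewrite finr; apply/esym/negP => /tP; rewrite in_vertex_part.
- exact: card_imset.
apply/subsetP/subsetP => st x; first by have := st (inl x); rewrite !finl.
by case: x => [v|e]; rewrite ?finr // !finl => /st.
Qed.

Lemma closure_dowker_homology n :
  lmod_iso (closure_homology H n) (homology dowker_complex n).
Proof.
exact: lmod_iso_trans (closure_vertex_homology n) (vertex_complex_homology n).
Qed.

End DowkerComplex.

(** * Duality of the Dowker complex *)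

Definition sum_swap (A B : Type) (x : A + B) : B + A :=
  match x with inl a => inr a | inr b => inl b end.

Lemma sum_swapK A B : cancel (@sum_swap A B) (@sum_swap B A).
Proof. by case. Qed.

(** Swapping the summands is an isomorphism of complexes: a vertex common to the hyperedges of a
    simplex becomes a hyperedge of the dual containing its vertices, and conversely, so the two
    existence clauses trade places. *)
Lemma dowker_dual_homology (H : hypergraph) n :
  lmod_iso (homology (dowker_complex H) n)
    (homology (dowker_complex (dual H)) n).
Proof.
have swI A B := can_inj (@sum_swapK A B).
have swE (A B : finType) (s : {set A + B}) x :
    (x \in [set sum_swap y | y in s]) = (sum_swap x \in s).
  by rewrite -{1}[x]sum_swapK (mem_imset _ _ (swI _ _)).
have swK (A B : finType) (s : {set A + B}) :
  [set sum_swap y | y in [set sum_swap y | y in s]] = s.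
  by apply/setP => x; rewrite !swE sum_swapK.
pose f (s : {set vertex H + edge H}) : {set vertex (dual H) + edge (dual H)} :=
  [set sum_swap y | y in s].
pose g (s : {set vertex (dual H) + edge (dual H)}) : {set vertex H + edge H} :=
  [set sum_swap y | y in s].
apply: (relabel_homology (f := f) (g := g)) => [s|s|s _|s _|s _|s t _ _].
- move=> /dowker_simplicesP[/set0Pn[x xs] [e se] [v sv] sR].
  apply/dowker_simplicesP; split.
  + by apply/set0Pn; exists (sum_swap x); rewrite swE sum_swapK.
  + by exists v => e'; rewrite swE inE => /sv.
  + by exists e => v'; rewrite swE inE => /se.
  by move=> e' v'; rewrite !swE inE => /= es vs; apply: sR.
- move=> /dowker_simplicesP[/set0Pn[x xs] [v sv] [e se] sR].
  apply/dowker_simplicesP; split.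
  + by apply/set0Pn; exists (sum_swap x); rewrite swE sum_swapK.
  + by exists e => v'; rewrite swE => /se; rewrite inE.
  + by exists v => e'; rewrite swE => /sv; rewrite inE.
  by move=> v' e'; rewrite !swE => /= vs es; have := sR _ _ es vs; rewrite inE.
- exact: swK.
- exact: swK.
- exact: (card_imset _ (swI _ _)).
apply/subsetP/subsetP => st x; last by rewrite !swE => /st.
by have := st (sum_swap x); rewrite !swE sum_swapK.
Qed.

Theorem proposition8 (H : hypergraph) :
  forall n : nat,
    lmod_iso (closure_homology H n) (closure_homology (dual H) n).
Proof.
move=> n; apply: lmod_iso_trans (closure_dowker_homology H n) _.
apply: lmod_iso_trans (dowker_dual_homology H n) _.
exact/lmod_iso_sym/closure_dowker_homology.
Qed.
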